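(* Let $\mathcal C$ be an idempotent and consistent convergence class operation. Then $\mathbf{Top}_{\mathcal C}$ is a coreflective subcategory of $\mathbf{Top}$.
   Context: All spaces are $T_0$; $\mathbf{Top}$ is the category of $T_0$ spaces and continuous maps. A convergence class $\mathcal E$ on a set $X$ is a class of pairs $(\xi,x)$ with $\xi$ a net in $X$ and $x\in X$. It determines a topology $\mathcal E(X)$ on $X$: $U\in\mathcal E(X)$ iff for all $(\xi,x)\in\mathcal E$, $x\in U$ implies that $\xi$ is eventually in $U$. For a space $X$, $\mathcal T_X$ denotes the class of all pairs $(\xi,x)$ such that the net $\xi$ converges to $x$ in $X$. A convergence class operation $\mathcal C$ assigns to every space $X$ a convergence class $\mathcal C_X\subseteq\mathcal T_X$ on $X$; write $\mathcal CX=(X,\mathcal C_X(X))$ for $X$ with the topology determined by $\mathcal C_X$. $\mathcal C$ is idempotent if $\mathcal C_X\subseteq\mathcal C_{\mathcal CX}$ for every space $X$. $\mathcal C$ is consistent if for every continuous $f:X\to Y$, $(\xi,x)\in\mathcal C_X$ implies $(f(\xi),f(x))\in\mathcal C_Y$, where $f(\xi)$ is the image net. $X$ is $\mathcal C$-determined if $X=\mathcal CX$. A map $f:X\to Y$ is $\mathcal C$-continuous if $f:\mathcal CX\to\mathcal CY$ is continuous. $\mathbf{Top}_{\mathcal C}$ is the category of $\mathcal C$-determined spaces and $\mathcal C$-continuous maps (for maps between $\mathcal C$-determined spaces this is the same as continuous, so it is a full subcategory of $\mathbf{Top}$). A subcategory $\mathbf A$ of $\mathbf B$ is coreflective if for each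 $\mathbf B$-object $B$ there are an $\mathbf A$-object $A$ and a $\mathbf B$-morphism $c:A\to B$ such that for every $\mathbf B$-morphism $f:A'\to B$ from an $\mathbf A$-object $A'$ there is a unique $\mathbf A$-morphism $f':A'\to A$ with $f=c\circ f'$. *)

(* Defs.v *)
(* MathComp-Analysis *)
From HB Require Import structures.
From mathcomp Require Import all_boot all_order all_classical.
From mathcomp Require Import topology.

Set Implicit Arguments.
Unset Strict Implicit.
Unset Printing Implicit Defensive.

Local Open Scope classical_set_scope.

(* A directed set is a nonempty, not necessarily antisymmetric, preorder in
   which any two elements have an upper bound. *)
Record directed_set := DirectedSet {
  dir_sort :> Type;
  dir_le : dir_sort -> dir_sort -> Prop;
  dir_inhabited : inhabited dir_sort;
  dir_refl : forall i, dir_le i i;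
  dir_trans : forall j i k, dir_le i j -> dir_le j k -> dir_le i k;
  dir_ub : forall i j, exists k, dir_le i k /\ dir_le j k }.

Definition tails (D : directed_set) : set_system D :=
  [set P | exists i, forall j, dir_le i j -> P j].

#[global] Instance tails_proper_filter (D : directed_set) :
  ProperFilter (@tails D).
Proof.
apply: Build_ProperFilter_ex => [P [i iP]|].
  by exists i; apply: iP; exact: dir_refl.
split.
- by case: (dir_inhabited D) => i; exists i.
- move=> P Q [i iP] [j jQ]; have [k [ik jk]] := dir_ub i j.
  by exists k => l kl; split; [apply: iP|apply: jQ]; apply: dir_trans kl.
- by move=> P Q PQ [i iP]; exists i => j /iP /PQ.
Qed.

Record net (T : Type) := Net {
  net_index : directed_set;
  net_fun :> net_index -> T }.

Definition net_map (S T : Type) (f : S -> T) (xi : net S) : net T :=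
  Net (f \o xi).

Definition eventually_in (T : Type) (xi : net T) (U : set T) : Prop :=
  \forall i \near @tails (net_index xi), U (xi i).

Definition net_cvg (X : topologicalType) (xi : net X) (x : X) : Prop :=
  xi i @[i --> @tails (net_index xi)] --> x.

Definition convergence_class (T : Type) := set (net T * T).

Definition class_open (T : Type) (E : convergence_class T) : set_system T :=
  [set U | forall xi x, E (xi, x) -> U x -> eventually_in xi U].

(* The set T with the topology determined by E. *)
Definition class_space (T : Type) (E : convergence_class T) : Type := T.

Section class_space_topology.
Variables (T : choiceType) (E : convergence_class T).

HB.instance Definition _ := Choice.copy (class_space E) T.

Lemma class_openT : class_open E setT.
Proof. by move=> xi x _ _; apply: filterT. Qed.

Lemma class_openI : setI_closed (class_open E).
Proof.
move=> U V oU oV xi x Exi [Ux Vx].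
by apply: filterI; [apply: oU Exi Ux|apply: oV Exi Vx].
Qed.

Lemma class_open_bigU (I : Type) (f : I -> set T) :
  (forall i, class_open E (f i)) -> class_open E (\bigcup_i f i).
Proof.
move=> of_ xi x Exi [i _ fix_].
by apply: filterS (of_ i _ _ Exi fix_) => j fj; exists i.
Qed.

HB.instance Definition _ := isOpenTopological.Build (class_space E)
  class_openT class_openI class_open_bigU.

Lemma class_space_openE : @open (class_space E) = class_open E.
Proof. by []. Qed.

End class_space_topology.

Record T0Space := MkT0Space {
  T0_sort :> topologicalType;
  T0P : kolmogorov_space T0_sort }.

Definition class_of_space (X : topologicalType) : convergence_class X :=
  [set p | net_cvg p.1 p.2].

Record conv_class_op := ConvClassOp {
  op_class :> forall X : T0Space, convergence_class X;
  op_class_sub : forall X : T0Space, @op_class X `<=` @class_of_space X }.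

Arguments op_class : clear implicits.

Lemma op_class_finer (C : conv_class_op) (X : T0Space) (U : set X) :
  open U -> open (U : set (class_space (C X))).
Proof.
move=> oU; rewrite class_space_openE => xi x /(@op_class_sub C X (xi, x)) xix Ux.
by apply: xix; apply: open_nbhs_nbhs.
Qed.

Lemma op_space_T0 (C : conv_class_op) (X : T0Space) :
  kolmogorov_space (class_space (C X)).
Proof.
have finer (x : X) (A : set X) : nbhs x A ->
    nbhs (x : class_space (C X)) (A : set (class_space (C X))).
  rewrite nbhsE => -[B [oB Bx] BA]; rewrite nbhsE; exists B => //.
  by split=> //; apply: op_class_finer.
move=> x y /(@T0P X) [A [] [Ax Ay]]; exists A; [left|right]; split=> //;
  by move: Ax; rewrite !inE; apply: finer.
Qed.

(* The space CX. *)
Definition op_space (C : conv_class_op) (X : T0Space) : T0Space :=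
  MkT0Space (@op_space_T0 C X).

(* X and CX share their carrier definitionally, which is what makes the
   statements below well typed. *)
Definition idempotent_op (C : conv_class_op) : Prop :=
  forall (X : T0Space) (xi : net X) (x : X),
    C X (xi, x) -> C (op_space C X) (xi, x).

Definition consistent_op (C : conv_class_op) : Prop :=
  forall (X Y : T0Space) (f : X -> Y), continuous f ->
  forall (xi : net X) (x : X), C X (xi, x) -> C Y (net_map f xi, f x).

(* Equality of the spaces X and CX is equality of their topologies. *)
Definition determined (C : conv_class_op) (X : T0Space) : Prop :=
  forall U : set X, open U <-> open (U : set (op_space C X)).

Definition op_continuous (C : conv_class_op) (X Y : T0Space) (f : X -> Y) :
    Prop :=
  continuous (f : op_space C X -> op_space C Y).

Lemma op_continuousE (C : conv_class_op) (X Y : T0Space) (f : X -> Y) :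
  determined C X -> determined C Y -> op_continuous C f <-> continuous f.
Proof.
move=> dX dY; rewrite /op_continuous; split=> /continuousP fc.
  by apply/continuousP => V /dY /fc /dX.
by apply/continuousP => V /dY /fc /dX.
Qed.

Record category := Category {
  cat_ob :> Type;
  hom : cat_ob -> cat_ob -> Type;
  idm : forall X, hom X X;
  comp : forall X Y Z, hom Y Z -> hom X Y -> hom X Z;
  comp_idl : forall X Y (f : hom X Y), comp (idm Y) f = f;
  comp_idr : forall X Y (f : hom X Y), comp f (idm X) = f;
  comp_assoc : forall X Y Z W (h : hom Z W) (g : hom Y Z) (f : hom X Y),
    comp h (comp g f) = comp (comp h g) f }.

(* Only the morphisms satisfying sub_hom between objects satisfying sub_ob
   belong to the subcategory. *)
Record subcategory (B : category) := Subcategory {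
  sub_ob : B -> Prop;
  sub_hom : forall X Y : B, hom X Y -> Prop;
  sub_idm : forall X : B, sub_ob X -> sub_hom (idm X);
  sub_comp : forall (X Y Z : B) (g : hom Y Z) (f : hom X Y),
    sub_ob X -> sub_ob Y -> sub_ob Z ->
    sub_hom g -> sub_hom f -> sub_hom (comp g f) }.

Definition coreflective (B : category) (A : subcategory B) : Prop :=
  forall b : B, exists (a : B) (c : hom a b), sub_ob A a /\
    forall (a' : B) (f : hom a' b), sub_ob A a' ->
      exists! f' : hom a' a, sub_hom A f' /\ f = comp c f'.

Definition Top_comp (X Y Z : T0Space) (g : continuousType Y Z)
    (f : continuousType X Y) : continuousType X Z := g \o f.

Lemma Top_comp_idl (X Y : T0Space) (f : continuousType X Y) :
  Top_comp idfun f = f.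
Proof. exact/continuousEP. Qed.

Lemma Top_comp_idr (X Y : T0Space) (f : continuousType X Y) :
  Top_comp f idfun = f.
Proof. exact/continuousEP. Qed.

Lemma Top_comp_assoc (X Y Z W : T0Space) (h : continuousType Z W)
    (g : continuousType Y Z) (f : continuousType X Y) :
  Top_comp h (Top_comp g f) = Top_comp (Top_comp h g) f.
Proof. exact/continuousEP. Qed.

Definition Top : category := Category Top_comp_idl Top_comp_idr Top_comp_assoc.

Lemma op_continuous_id (C : conv_class_op) (X : T0Space) :
  op_continuous C (@idfun X).
Proof. by move=> x. Qed.

Lemma op_continuous_comp (C : conv_class_op) (X Y Z : T0Space)
    (g : Y -> Z) (f : X -> Y) :
  op_continuous C g -> op_continuous C f -> op_continuous C (g \o f).
Proof.
move=> cg cf x; exact: (@continuous_comp (op_space C X) (op_space C Y)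
  (op_space C Z) f g x (cf x) (cg (f x))).
Qed.

(* Taking the C-continuous maps among the morphisms of Top loses none of them:
   between C-determined spaces they are all continuous (op_continuousE). *)
Definition Top_op (C : conv_class_op) : subcategory Top :=
  @Subcategory Top (determined C)
    (fun X Y (f : continuousType X Y) => op_continuous C f)
    (fun X _ => @op_continuous_id C X)
    (fun X Y Z g f _ _ _ => @op_continuous_comp C X Y Z g f).

(* Main.v *)
From HB Require Import structures.
From mathcomp Require Import all_boot all_classical.
From mathcomp Require Import topology.
Require Import Defs.

Local Open Scope classical_set_scope.

(** The coreflection of a space [X] is the identity map from [CX] to [X], which
    is continuous because the topology of [CX] is the finer one
    ([op_class_finer]). Idempotence says that [CX] has at least the
    distinguished pairs of [X], so passing from [CX] to [CCX] adds no open set: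
    [CX] is determined ([op_space_determined]). Consistency makes the passage
    from [X] to [CX] functorial ([consistent_op_continuous]); hence a continuous
    map from a determined space [A] = [CA] to [X] is also continuous from [A] to
    [CX] ([determined_continuous_lift]). This is the required factorization, and
    it is unique since the coreflection is the identity on points. *)

Lemma op_space_openP (C : conv_class_op) (X : T0Space) (U : set X) :
  open (U : set (op_space C X)) <-> class_open (C X) U.
Proof. by rewrite -class_space_openE. Qed.

Lemma op_space_determined (C : conv_class_op) (X : T0Space) :
  idempotent_op C -> determined C (op_space C X).
Proof.
move=> idemC U; split; first exact: op_class_finer.
move=> oU; apply/op_space_openP => xi x Cxi Ux.
have /op_space_openP oU' := oU.
exact: oU' (idemC _ _ _ Cxi) Ux.
Qed.

Lemma op_space_continuous (C : conv_class_op) (X : T0Space) :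
  continuous (idfun : op_space C X -> X).
Proof. by apply/continuousP => U; exact: (@op_class_finer C X U). Qed.

(** A net [xi] is eventually in the preimage of [V] exactly when its image is
    eventually in [V], and consistency keeps that image distinguished. *)
Lemma consistent_op_continuous (C : conv_class_op) (X Y : T0Space)
    (f : X -> Y) :
  consistent_op C -> continuous f -> op_continuous C f.
Proof.
move=> consC cf; apply/continuousP => V /op_space_openP oV.
apply/op_space_openP => xi x Cxi Vfx.
exact: oV (consC _ _ _ cf _ _ Cxi) Vfx.
Qed.

Lemma determined_continuous_lift (C : conv_class_op) (A X : T0Space)
    (f : A -> X) :
  consistent_op C -> determined C A -> continuous f ->
  continuous (f : A -> op_space C X).
Proof.
move=> consC dA /(consistent_op_continuous C A X f consC) /continuousP cf.
by apply/continuousP => V /cf /dA.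
Qed.

Theorem theorem27 (C : conv_class_op) (C_idempotent : idempotent_op C)
    (C_consistent : consistent_op C) :
  coreflective (Top_op C).
Proof.
move=> X.
pose c : continuousType (op_space C X) X :=
  HB.pack (idfun : op_space C X -> X)
    (isContinuous.Build _ _ _ (op_space_continuous C X)).
exists (op_space C X), c; split; first exact: op_space_determined.
move=> A f dA.
pose f' : continuousType A (op_space C X) :=
  HB.pack (f : A -> op_space C X)
    (isContinuous.Build _ _ _
      (determined_continuous_lift C A X f C_consistent dA (@cts_fun _ _ f))).
exists f'; split.
  split; last exact/continuousEP.
  exact: (consistent_op_continuous C A (op_space C X) f' C_consistent
    (@cts_fun _ _ f')).
move=> g [_ fE]; apply/continuousEP => x.
exact: (congr1 (fun h : continuousType A X => h x) fE).
Qed.
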